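(* Let $X$ be a finite biquandle, let $S\subset \mathrm{Hom}(X,X)$ be a set of biquandle endomorphisms of $X$, let $A$ be an abelian group, and let $W$ be a biquandle arrow weight for $X$ with coefficients in $A$. Then the arrow weight in-degree polynomial $$\Phi_{X,W,S}^{\mathrm{deg}_+}(K)=\sum_{v\in V} u^{w(v)}w^{\deg_+(v)}$$ and the arrow weight two-variable polynomial $$\Phi_{X,W,S}^{2}(K)=\sum_{e\in E} s^{w(S(e))}t^{w(T(e))}$$ are invariants of oriented classical and virtual knots $K$; that is, if $D$ and $D'$ are Gauss diagrams representing the same oriented (classical or virtual) knot, then the values of each of these polynomials computed from $D$ and from $D'$ are equal.
   Context: **Biquandles.** A biquandle is a set $X$ with two binary operations $\underline{\triangleright},\overline{\triangleright}$ such that for all $x,y,z\in X$: (i) $x\,\underline{\triangleright}\,x=x\,\overline{\triangleright}\,x$; (ii) the maps $\alpha_y,\beta_y:X\to X$, $\alpha_y(x)=x\,\overline{\triangleright}\,y$, $\beta_y(x)=x\,\underline{\triangleright}\,y$, and the map $X\times X\to X\times X$, $(x,y)\mapsto (y\,\overline{\triangleright}\,x,\ x\,\underline{\triangleright}\,y)$, are bijective; (iii) $(x\,\underline{\triangleright}\,y)\,\underline{\triangleright}\,(z\,\underline{\triangleright}\,y)=(x\,\underline{\triangleright}\,z)\,\underline{\triangleright}\,(y\,\overline{\triangleright}\,z)$, $(x\,\underline{\triangleright}\,y)\,\overline{\triangleright}\,(z\,\underline{\triangleright}\,y)=(x\,\overline{\triangleright}\,z)\,\underline{\triangleright}\,(y\,\overline{\triangleright}\,z)$,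 $(x\,\overline{\triangleright}\,y)\,\overline{\triangleright}\,(z\,\overline{\triangleright}\,y)=(x\,\overline{\triangleright}\,z)\,\overline{\triangleright}\,(y\,\underline{\triangleright}\,z)$. A biquandle endomorphism is a map $\phi:X\to X$ with $\phi(x\,\underline{\triangleright}\,x')=\phi(x)\,\underline{\triangleright}\,\phi(x')$ and $\phi(x\,\overline{\triangleright}\,x')=\phi(x)\,\overline{\triangleright}\,\phi(x')$ for all $x,x'\in X$; $\mathrm{Hom}(X,X)$ is the set of these. **Gauss diagrams.** A Gauss diagram is an oriented circle with finitely many arrows (directed chords with distinct endpoints on the circle), each with a sign $\pm1$, up to orientation-preserving homeomorphism of the circle. The arrows correspond to the real crossings of an oriented virtual knot diagram; each points from the overcrossing point (tail) to the undercrossing point (head), and its sign is the local writhe. Oriented virtual knots are the equivalence classes of Gauss diagrams under the Gauss diagram Reidemeister moves, generated by: (I) adding or removing an arrow of any sign and direction whose two endpoints are adjacent on the circle; (II) adding or removing two arrows of opposite signs whose tails are adjacent and whose heads are adjacent; (III) given three positive arrows $p,q,r$ and three disjoint arcs of the circle which contain, in the order of the orientation and with no other endpoints, (head of $p$, head of $q$), (tail of $p$, head of $r$), (tail of $q$, tail of $r$) respectively, reversing the order of the two endpoints in each of the three arcs (or the inverse of this). (The other oriented versions of move III are consequences of these.) Classical knots are the virtual knots represented by Gauss diagrams of classical knot diagrams. **Colorings.** The segments of a Gauss diagram are the components of the circle minus the arrow endpoints. An $X$-coloring assigns an element of $X$ to each segment so that at each arrow there are $x,y\in X$ such that: if the arrow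 is positive, the segments just before and just after its head are colored $x$ and $x\,\underline{\triangleright}\,y$, and those just before and just after its tail are colored $y\,\overline{\triangleright}\,x$ and $y$; if the arrow is negative, the segments just before and just after its head are colored $x\,\underline{\triangleright}\,y$ and $x$, and those just before and just after its tail are colored $y$ and $y\,\overline{\triangleright}\,x$. The arrow is then labeled by the ordered pair $(x,y)$. If two Gauss diagrams differ by a Reidemeister move, each $X$-coloring of one determines a unique $X$-coloring of the other agreeing with it outside the neighborhood of the move; such a pair of $X$-colored diagrams is said to be related by an $X$-colored Reidemeister move. Applying $\phi\in\mathrm{Hom}(X,X)$ to all segment colors of an $X$-coloring $f$ gives an $X$-coloring $\phi(f)$. **Biquandle arrow weights.** For a function $W:(X\times X)\times(X\times X)\to A$ and an $X$-colored Gauss diagram, let $\Sigma_D\in A$ be the sum, over all pairs of arrows that cross each other (i.e. whose endpoints interleave on the circle), of $\varepsilon\varepsilon' W((a,b),(c,d))$, where $(a,b),(c,d)$ are the labels and $\varepsilon,\varepsilon'$ the signs of the two arrows. The first arrow of a crossing pair (label $(a,b)$) is the one for which, travelling along the oriented circle from its tail to its head, one meets the tail of the other arrow. A biquandle arrow weight for $X$ with coefficients in $A$ is such a function $W$ for which $\Sigma_D$ is unchanged by all $X$-colored Gauss diagram Reidemeister moves. **Weighted quiver.** For a Gauss diagram $D$ representing $K$, $\mathcal{Q}_{X,W,S}(K)$ is the directed multigraph whose vertices are the $X$-colorings of $D$, with one directed edge from $f$ to $\phi(f)$ for each vertex $f$ and each $\phi\in S$, where each vertex $f$ is given as weight the element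 $\Sigma_D\in A$ computed from the coloring $f$. **Polynomials.** $V$ and $E$ are the vertex set and edge set of $\mathcal{Q}_{X,W,S}(K)$; $w(v)\in A$ is the weight of the vertex $v$; $\deg_+(v)$ is the in-degree of $v$ (the number of edges directed into $v$); $S(e)$ and $T(e)$ are the source and target vertices of the edge $e$. The symbols $u,w,s,t$ are formal variables (the variable $w$ is distinct from the weight function $w(\cdot)$). Powers with exponents in $A$ are formal, so $\Phi_{X,W,S}^{\mathrm{deg}_+}(K)$ is a finite formal sum of elements of $A\times\mathbb{Z}_{\ge 0}$ and $\Phi_{X,W,S}^{2}(K)$ is a finite formal sum of elements of $A\times A$. *)

(* Defs.v *)
From HB Require Import structures.
From mathcomp Require Import all_boot all_order all_algebra.
From mathcomp Require Import finmap.
From mathcomp.multinomials Require Import monalg.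
From Stdlib Require Import Relation_Operators.

Set Implicit Arguments.
Unset Strict Implicit.
Unset Printing Implicit Defensive.

Import GRing.Theory.
Local Open Scope ring_scope.

(** * Biquandles

    [und] is the underlined triangle, written [x \_> y], and [ovr] is the
    overlined one, written [x \^> y]. *)

Record is_biquandle (X : Type) (und ovr : X -> X -> X) : Prop := IsBiquandle {
  bq_diag : forall x, und x x = ovr x x;
  bq_ovr_bij : forall y, bijective (fun x => ovr x y);
  bq_und_bij : forall y, bijective (fun x => und x y);
  bq_pair_bij : bijective (fun xy : X * X => (ovr xy.2 xy.1, und xy.1 xy.2));
  bq_exch1 : forall x y z,
    und (und x y) (und z y) = und (und x z) (ovr y z);
  bq_exch2 : forall x y z,
    ovr (und x y) (und z y) = und (ovr x z) (ovr y z);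
  bq_exch3 : forall x y z,
    ovr (ovr x y) (ovr z y) = ovr (ovr x z) (und y z)
}.

Record finBiquandle := FinBiquandle {
  bq_sort :> finType;
  und : bq_sort -> bq_sort -> bq_sort;
  ovr : bq_sort -> bq_sort -> bq_sort;
  bqP : is_biquandle und ovr
}.

Arguments und {_}.
Arguments ovr {_}.
Notation "x \_> y" := (und x y) (at level 40, no associativity).
Notation "x \^> y" := (ovr x y) (at level 40, no associativity).

Definition is_endo (X : finBiquandle) (phi : {ffun X -> X}) : bool :=
  [forall x, forall x', (phi (x \_> x') == phi x \_> phi x')
                     && (phi (x \^> x') == phi x \^> phi x')].

Definition endo (X : finBiquandle) : finType :=
  {phi : {ffun X -> X} | is_endo phi}.

(** * Gauss diagrams

    Choosing a base point on the circle away from the arrow endpoints turns a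
    Gauss diagram into the word of its endpoints, read along the orientation.
    An arrow is a name together with a sign ([true] for positive), so that the
    sign is the same at both ends; an endpoint is an arrow with a flag which
    is [true] at its head.  The choices of base point and of names are
    quotiented out by [homeo] below. *)

Definition arrow : Type := (nat * bool)%type.
Definition endpoint : Type := (arrow * bool)%type.

Definition positive (a : arrow) : bool := a.2.
Definition sgn (a : arrow) : int := if positive a then 1 else -1.
Definition head_of (a : arrow) : endpoint := (a, true).
Definition tail_of (a : arrow) : endpoint := (a, false).

Definition is_gauss (w : seq endpoint) : bool :=
  uniq w && all (fun e : endpoint => (e.1, ~~ e.2) \in w) w.

Record gaussDiagram := GaussDiagram {
  gword :> seq endpoint;
  gwordP : is_gauss gword
}.

Definition arrows (w : seq endpoint) : seq arrow := [seq e.1 | e <- w & e.2].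

Definition homeo (w w' : seq endpoint) : Prop :=
  exists (k : nat) (g : arrow -> arrow),
    [/\ {in arrows w &, injective g},
        {in arrows w, forall a, positive (g a) = positive a}
      & w' = [seq (g e.1, e.2) | e <- rot k w]].

(** Up to [homeo], the base point may be taken just before one of the arcs
    where a move takes place.  Moves I and II are written in the removing
    direction.  The two constructors for move III are the two cyclic orders in
    which its three arcs can occur on the circle. *)

Inductive rmove : seq endpoint -> seq endpoint -> Prop :=
| RMove1 a b v :
    rmove ([:: (a, b); (a, ~~ b)] ++ v) v
| RMove2 a a' s t u v :
    positive a' = ~~ positive a ->
    perm_eq s [:: tail_of a; tail_of a'] ->
    perm_eq t [:: head_of a; head_of a'] ->
    rmove (s ++ u ++ t ++ v) (u ++ v)
| RMove3 p q r u v z :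
    positive p -> positive q -> positive r ->
    rmove ([:: head_of p; head_of q] ++ u ++ [:: tail_of p; head_of r] ++ v
             ++ [:: tail_of q; tail_of r] ++ z)
          ([:: head_of q; head_of p] ++ u ++ [:: head_of r; tail_of p] ++ v
             ++ [:: tail_of r; tail_of q] ++ z)
| RMove3' p q r u v z :
    positive p -> positive q -> positive r ->
    rmove ([:: head_of p; head_of q] ++ u ++ [:: tail_of q; tail_of r] ++ v
             ++ [:: tail_of p; head_of r] ++ z)
          ([:: head_of q; head_of p] ++ u ++ [:: tail_of r; tail_of q] ++ v
             ++ [:: head_of r; tail_of p] ++ z).

Definition gauss_step (D D' : gaussDiagram) : Prop :=
  homeo D D' \/ rmove D D'.

Definition same_virtual_knot : gaussDiagram -> gaussDiagram -> Prop :=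
  clos_refl_sym_trans gaussDiagram gauss_step.

(** * Colorings

    The base point cuts the segment containing it in two, so a word of length
    [n] has [n.+1] consecutive pieces of segments, the piece [i] being just
    before the [i]-th endpoint and the piece [i.+1] just after it; the first
    and last pieces must have the same color.  For [n = 0] the only piece is
    the whole circle. *)

Section Colorings.
Context {X : finBiquandle}.

Definition before (w : seq endpoint) (f : (size w).+1.-tuple X)
  (e : endpoint) : X := tnth f (inord (index e w)).

Definition after (w : seq endpoint) (f : (size w).+1.-tuple X)
  (e : endpoint) : X := tnth f (inord (index e w).+1).

Definition colored_by (w : seq endpoint) (f : (size w).+1.-tuple X)
    (a : arrow) (xy : X * X) : bool :=
  let: (x, y) := xy in
  if positive a then
    [&& before f (head_of a) == x, after f (head_of a) == x \_> y,
        before f (tail_of a) == y \^> x & after f (tail_of a) == y]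
  else
    [&& before f (head_of a) == x \_> y, after f (head_of a) == x,
        before f (tail_of a) == y & after f (tail_of a) == y \^> x].

(** The only pair which can satisfy [colored_by f a]. *)
Definition label (w : seq endpoint) (f : (size w).+1.-tuple X)
    (a : arrow) : X * X :=
  if positive a then (before f (head_of a), after f (tail_of a))
  else (after f (head_of a), before f (tail_of a)).

Definition is_coloring (w : seq endpoint) (f : (size w).+1.-tuple X) : bool :=
  (tnth f ord0 == tnth f ord_max)
  && all (fun a => colored_by f a (label f a)) (arrows w).

End Colorings.

Definition coloring (X : finBiquandle) (w : seq endpoint) : finType :=
  {f : (size w).+1.-tuple X | is_coloring f}.

Lemma is_coloring_act (X : finBiquandle) (w : seq endpoint) (phi : endo X)
  (f : coloring X w) : is_coloring (map_tuple (val phi) (val f)).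
Proof.
have Hu x y : val phi (x \_> y) = val phi x \_> val phi y.
  by have /forallP/(_ x)/forallP/(_ y)/andP[/eqP] := valP phi.
have Ho x y : val phi (x \^> y) = val phi x \^> val phi y.
  by have /forallP/(_ x)/forallP/(_ y)/andP[_ /eqP] := valP phi.
have /andP[/eqP Hc /allP Ha] := valP f.
apply/andP; split; first by rewrite !tnth_map Hc.
apply/allP => a /Ha; rewrite /colored_by /label /before /after !tnth_map.
by case: (positive a) => /and4P[/eqP h1 /eqP h2 /eqP h3 /eqP h4];
   rewrite -?Hu -?Ho -?h1 -?h2 -?h3 -?h4 !eqxx.
Qed.

Definition act (X : finBiquandle) (w : seq endpoint) (phi : endo X)
    (f : coloring X w) : coloring X w :=
  Sub (map_tuple (val phi) (val f)) (is_coloring_act phi f).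

(** * Colored moves

    A colored word is given by the color [x] of its first piece and, for each
    endpoint, the color of the piece just after it.  Forgetting the colors
    gives the constructors of [rmove].  The segments entering and leaving an
    arc where the move takes place keep their colors; only the colors strictly
    inside such an arc may change. *)

Inductive colored_rmove (X : Type) (x : X) :
    seq (endpoint * X) -> seq (endpoint * X) -> Prop :=
| CRMove1 a b y v :
    colored_rmove x ([:: ((a, b), y); ((a, ~~ b), x)] ++ v) v
| CRMove2 a a' s s' t t' y y' x2 u v :
    positive a' = ~~ positive a ->
    perm_eq [:: s; s'] [:: tail_of a; tail_of a'] ->
    perm_eq [:: t; t'] [:: head_of a; head_of a'] ->
    x2 = last x (unzip2 u) ->
    colored_rmove x
      ([:: (s, y); (s', x)] ++ u ++ [:: (t, y'); (t', x2)] ++ v) (u ++ v)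
| CRMove3 p q r x1 x2 x3 y1 y2 y3 y1' y2' y3' u v z :
    positive p -> positive q -> positive r ->
    colored_rmove x
      ([:: (head_of p, y1); (head_of q, x1)] ++ u
         ++ [:: (tail_of p, y2); (head_of r, x2)] ++ v
         ++ [:: (tail_of q, y3); (tail_of r, x3)] ++ z)
      ([:: (head_of q, y1'); (head_of p, x1)] ++ u
         ++ [:: (head_of r, y2'); (tail_of p, x2)] ++ v
         ++ [:: (tail_of r, y3'); (tail_of q, x3)] ++ z)
| CRMove3' p q r x1 x2 x3 y1 y2 y3 y1' y2' y3' u v z :
    positive p -> positive q -> positive r ->
    colored_rmove x
      ([:: (head_of p, y1); (head_of q, x1)] ++ u
         ++ [:: (tail_of q, y2); (tail_of r, x2)] ++ v
         ++ [:: (tail_of p, y3); (head_of r, x3)] ++ z)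
      ([:: (head_of q, y1'); (head_of p, x1)] ++ u
         ++ [:: (tail_of r, y2'); (tail_of q, x2)] ++ v
         ++ [:: (head_of r, y3'); (tail_of p, x3)] ++ z).

Definition colored_move (X : finBiquandle) (D D' : gaussDiagram)
    (f : coloring X D) (f' : coloring X D') : Prop :=
  exists (x : X) (c c' : seq (endpoint * X)),
    [/\ colored_rmove x c c',
        gword D = unzip1 c /\ tval (val f) = x :: unzip2 c
      & gword D' = unzip1 c' /\ tval (val f') = x :: unzip2 c'].

(** * Biquandle arrow weights *)

(** [e] is met when travelling along the oriented circle from the tail of [a]
    to its head. *)
Definition meets (w : seq endpoint) (a : arrow) (e : endpoint) : bool :=
  let w' := rot (index (tail_of a) w) w in
  (index e w' < index (head_of a) w')%N.

Definition crosses (w : seq endpoint) (a b : arrow) : bool :=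
  (a != b) && (meets w a (tail_of b) != meets w a (head_of b)).

(** Exactly one of the two orderings of each crossing pair is counted: the one
    in which the first arrow [a] meets the tail of [b]. *)
Definition Sigma (X : finBiquandle) (A : zmodType)
    (W : (X * X) * (X * X) -> A) (w : seq endpoint) (f : coloring X w) : A :=
  \sum_(a <- arrows w)
   \sum_(b <- arrows w | crosses w a b && meets w a (tail_of b))
     W (label (val f) a, label (val f) b) *~ (sgn a * sgn b).

Definition arrow_weight (X : finBiquandle) (A : zmodType)
    (W : (X * X) * (X * X) -> A) : Prop :=
  forall (D D' : gaussDiagram) (f : coloring X D) (f' : coloring X D'),
    colored_move f f' -> Sigma W f = Sigma W f'.

(** * Weighted quivers and their polynomials *)

Record weighted_quiver (A : Type) := WeightedQuiver {
  vertex : finType;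
  edge : finType;
  source : edge -> vertex;
  target : edge -> vertex;
  vweight : vertex -> A
}.

Definition quiver (X : finBiquandle) (A : zmodType)
    (W : (X * X) * (X * X) -> A) (S : {set endo X}) (D : gaussDiagram) :
    weighted_quiver A :=
  {| vertex := coloring X D;
     edge := (coloring X D * {phi : endo X | phi \in S})%type;
     source := fun e => e.1;
     target := fun e => act (val e.2) e.1;
     vweight := fun f => Sigma W f |}.

Definition indegree (A : Type) (Q : weighted_quiver A) (v : vertex Q) : nat :=
  #|[set e : edge Q | target e == v]|.

(** Formal sums are elements of the free abelian group on pairs of exponents:
    [<< (g, n) >>] stands for the monomial with exponents [g] and [n]. *)

Definition indegree_polynomial (A : zmodType) (Q : weighted_quiver A) :
    {malg int[(A * nat)%type]} :=
  \sum_(v : vertex Q) << (vweight v, indegree v) >>.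

Definition two_variable_polynomial (A : zmodType) (Q : weighted_quiver A) :
    {malg int[(A * A)%type]} :=
  \sum_(e : edge Q) << (vweight (source e), vweight (target e)) >>.

(* Main.v *)
Require Import Defs.
From mathcomp Require Import all_boot all_order all_algebra.
From mathcomp.multinomials Require Import monalg.

Set Implicit Arguments.
Unset Strict Implicit.
Unset Printing Implicit Defensive.

Local Open Scope ring_scope.

(** Why the polynomials are invariant.  If a bijection between the colorings
    of [D] and those of [D'] commutes with the action of the endomorphisms and
    preserves [Sigma], it is an isomorphism of weighted quivers, so that both
    polynomials agree ([quiver_iso]).  It is enough to find such a bijection
    for one homeomorphism and for one Reidemeister move.

    Everything is done with colored words.  A coloring of [w] is the color [x]
    of the first piece with a word [c] of endpoints, each carrying the color
    of the piece after it, such that the colors close up and every endpoint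
    sees the colors prescribed by some labelling [L] of the arrows by pairs
    ([is_coloringP]).  The condition [labelled L x c] is local: it splits along
    concatenations, which makes rotating or rewriting a word easy.

    A homeomorphism is a rotation followed by a renaming.  Rotating [c] keeps
    [L], and renaming keeps the colors; both preserve the cyclic arcs which
    decide whether two arrows cross ([meets_arc], [eq_Sigma]).

    The moves are all treated as the replacement of a tangle made of at most
    three arcs.  Two local properties suffice ([exchangeable]): each solution
    of the coloring equations in one tangle can be replaced by one in the other
    tangle with the same entry and exit colors, and the entry colors determine
    a solution.  They give a bijection between the colorings, related as in a
    colored move, so the arrow weight hypothesis gives the equality of [Sigma]
    ([same_polynomials_replace]).  Locally, move I holds because
    [x \_> y = y \^> x] forces [x = y] ([und_eq_ovr]), move II because
    crossings of opposite signs undo each other ([strand_colors_opp]) and their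
    common label is determined by the entry colors ([entry_colors_bij]), and
    move III by the exchange laws ([exchangeable_triangle]). *)

(** * Sequences *)

Lemma perm_gather (T : eqType) (s1 s2 s3 u v z : seq T) :
  perm_eq ((s1 ++ s2 ++ s3) ++ (u ++ v ++ z))
          (s1 ++ u ++ s2 ++ v ++ s3 ++ z).
Proof.
rewrite -!catA perm_cat2l perm_sym perm_catCA perm_cat2l catA perm_catCA.
by rewrite perm_cat2l catA.
Qed.

Lemma index_map_in (T T' : eqType) (h : T -> T') s x :
  {in s &, injective h} -> x \in s -> index (h x) (map h s) = index x s.
Proof.
elim: s => //= y s IH hinj xs.
rewrite (inj_in_eq hinj) ?mem_head //; case: eqVneq => // neq; congr _.+1.
apply: IH; first by move=> u v us vs; apply: hinj; rewrite inE ?us ?vs orbT.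
by move: xs; rewrite inE eq_sym (negbTE neq).
Qed.

Lemma perm_eq_pair (T : eqType) (s : seq T) (m n : T) :
  perm_eq s [:: m; n] -> s = [:: m; n] \/ s = [:: n; m].
Proof.
case: s => [|m1 [|n1 [|? ?]]] // h; try by have := perm_size h.
have := perm_mem h m1; rewrite !inE eqxx /= => /esym/orP[]/eqP ?; subst m1.
  by left; move: h; rewrite perm_cons => /perm_small_eq -> //.
right; move: h; rewrite perm_sym (perm_catC [:: m] [:: n]) perm_cons.
by move=> /perm_small_eq -> //.
Qed.

(** * Colors at a crossing *)

Section Biquandle.
Context {X : finBiquandle}.
Implicit Types (x y z : X) (l : X * X).

Lemma ovr_inj z : injective (fun x : X => x \^> z).
Proof. exact/bij_inj/(bq_ovr_bij (bqP X)). Qed.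

Lemma und_inj z : injective (fun x : X => x \_> z).
Proof. exact/bij_inj/(bq_und_bij (bqP X)). Qed.

Lemma und_diag_inj : injective (fun x : X => x \_> x).
Proof.
move=> x y /= e; have /bij_inj h := bq_pair_bij (bqP X).
by have [] : (x, x) = (y, y) by apply: h; rewrite /= -!(bq_diag (bqP X)) e.
Qed.

(** The diagonal map is injective, hence onto since [X] is finite: the common
    value is [z \_> z = z \^> z] for some [z], and the pairs [(x, y)] and
    [(z, z)] then have the same image under the bijective pair map. *)
Lemma und_eq_ovr x y : x \_> y = y \^> x -> x = y.
Proof.
move=> e; have [g _ gK] := injF_bij und_diag_inj.
have /bij_inj h := bq_pair_bij (bqP X).
pose z := g (x \_> y); have ez : z \_> z = x \_> y by apply: gK.
by have [-> ->] : (x, y) = (z, z)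
  by apply: h; rewrite /= -!(bq_diag (bqP X)) -e ez.
Qed.

(** The colors before and after an endpoint of an arrow with label [l].  A
    negative crossing is a positive one traversed backwards, whence the swap. *)
Definition strand_colors (e : endpoint) (l : X * X) : X * X :=
  let: (x, y) := l in
  let c := if e.2 then (x, x \_> y) else (y \^> x, y) in
  if positive e.1 then c else (c.2, c.1).

(** The algebra behind move II: at arrows of opposite signs with the same
    label, a strand passing through both ends recovers its color. *)
Lemma strand_colors_opp a a' b l : positive a' = ~~ positive a ->
  strand_colors (a', b) l =
    ((strand_colors (a, b) l).2, (strand_colors (a, b) l).1).
Proof.
by rewrite /strand_colors => /= ->; case: l => x y; case: (positive a);
   case: b.
Qed.

(** The four combinations of signs are the four pairs of edges at a crossing,
    one on each strand; the two colors can be prescribed freely and determine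
    the label.  For [(x, y)] itself this is trivial, and the other three pairs
    are the three bijectivity axioms. *)
Lemma entry_colors_bij p q :
  bijective (fun l => ((strand_colors (tail_of p) l).1,
                       (strand_colors (head_of q) l).1)).
Proof.
apply: injF_bij => -[x y] [x' y']; rewrite /strand_colors /=.
case: (positive p) (positive q) => -[] /= [].
- by move=> + e; rewrite e => /ovr_inj ->.
- by move=> e1 e2; apply: (bij_inj (bq_pair_bij (bqP X))); rewrite /= e1 e2.
- by move=> -> ->.
- by move=> ->  /und_inj ->.
Qed.

(** A strand which crosses itself at once has a diagonal label. *)
Lemma kink_label a b l :
  (strand_colors (a, b) l).2 = (strand_colors (a, ~~ b) l).1 -> l.1 = l.2.
Proof.
case: l => x y; rewrite /strand_colors /=.
by case: (positive a) b => -[] //= /esym e; apply: und_eq_ovr.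
Qed.

Lemma kink_diag a b x :
  strand_colors (a, ~~ b) (x, x) =
  ((strand_colors (a, b) (x, x)).2, (strand_colors (a, b) (x, x)).1).
Proof.
by rewrite /strand_colors /= -(bq_diag (bqP X)); case: (positive a) b => -[].
Qed.

(** On diagonal labels the incoming color is [x] or [x \_> x], and both are
    bijective in [x]. *)
Lemma kink_entry_bij e : bijective (fun x => (strand_colors e (x, x)).1).
Proof.
apply: injF_bij => x y; rewrite /strand_colors /= -!(bq_diag (bqP X)).
by case: (positive _); case: e.2 => //= /und_diag_inj.
Qed.

(** * Labelled words *)

Implicit Types (L : arrow -> X * X) (c d : seq (endpoint * X)).

(** The equations of all endpoints are read along the word, so that they split
    along concatenations. *)
Fixpoint labelled L (x : X) c : bool :=
  if c is (e, y) :: c' then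
    ((x, y) == strand_colors e (L e.1)) && labelled L y c'
  else true.

Definition exit (x : X) c : X := last x (unzip2 c).

Lemma exit_cat x c d : exit x (c ++ d) = exit (exit x c) d.
Proof. by rewrite /exit /unzip2 map_cat last_cat. Qed.

Lemma labelled_cat L x c d :
  labelled L x (c ++ d) = labelled L x c && labelled L (exit x c) d.
Proof. by elim: c x => [|[e y] c IH] x //=; rewrite IH andbA. Qed.

Lemma eq_labelled L L' x c : (forall e, e \in unzip1 c -> L e.1 = L' e.1) ->
  labelled L x c = labelled L' x c.
Proof.
elim: c x => [|[e y] c IH] x //= h; rewrite h ?mem_head // IH // => e' he'.
by rewrite h // inE he' orbT.
Qed.

Definition recolor (phi : X -> X) c := [seq (p.1, phi p.2) | p <- c].

Lemma unzip1_recolor phi c : unzip1 (recolor phi c) = unzip1 c.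
Proof. by rewrite /unzip1 -map_comp. Qed.

Lemma unzip2_recolor phi c : unzip2 (recolor phi c) = map phi (unzip2 c).
Proof. by rewrite /unzip2 -!map_comp. Qed.

Lemma exit_recolor phi x c : exit (phi x) (recolor phi c) = phi (exit x c).
Proof. by rewrite /exit unzip2_recolor last_map. Qed.

Lemma unzip1_cat_inv c (s t : seq endpoint) : unzip1 c = s ++ t ->
  exists c1 c2, [/\ c = c1 ++ c2, unzip1 c1 = s & unzip1 c2 = t].
Proof.
move=> e; exists (take (size s) c), (drop (size s) c); rewrite cat_take_drop.
by rewrite /unzip1 map_take map_drop -/(unzip1 c) e take_size_cat ?drop_size_cat.
Qed.

Lemma unzip_inj c d : unzip1 c = unzip1 d -> unzip2 c = unzip2 d -> c = d.
Proof. by move=> e1 e2; rewrite -(zip_unzip c) e1 e2 zip_unzip. Qed.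

(** Since endpoints occur once, the recursive condition can be tested at the
    position of each endpoint, which is how [before] and [after] are defined. *)
Lemma labelledP L x c (x0 : X) : uniq (unzip1 c) ->
  reflect (forall e, e \in unzip1 c ->
             (nth x0 (x :: unzip2 c) (index e (unzip1 c)),
              nth x0 (unzip2 c) (index e (unzip1 c)))
             = strand_colors e (L e.1))
          (labelled L x c).
Proof.
elim: c x => [|[e y] c IH] x /= => [_|/andP[ne Uc]]; first by left.
apply: (iffP andP) => [[/eqP h /(IH y Uc) hc] e'|h].
  rewrite inE eq_sym; case: eqVneq => [<- _|_ /= /hc] //=.
split.
  by have := h e (mem_head _ _); rewrite eqxx /= => ->.
apply/(IH y Uc) => e' he'; have := h e'; rewrite inE he' orbT eq_sym => /(_ isT).
by case: eqVneq he' ne => [-> ->|].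
Qed.

Lemma mem_arrows (w : seq endpoint) e : is_gauss w -> e \in w ->
  e.1 \in arrows w.
Proof.
case/andP=> _ /allP h he; apply/mapP.
case: (boolP e.2) => he2; first by exists e; rewrite // mem_filter he2.
by exists (e.1, ~~ e.2); rewrite // mem_filter (h e he) andbT.
Qed.

Lemma arrows_mem (w : seq endpoint) a b : is_gauss w -> a \in arrows w ->
  (a, b) \in w.
Proof.
case/andP=> _ /allP h /mapP[[a' b']]; rewrite mem_filter /= => /andP[-> he] ->.
by case: b => //; apply: (h _ he).
Qed.

Section Word.
Variables (w : seq endpoint) (x : X) (c : seq (endpoint * X)).
Variable f : (size w).+1.-tuple X.
Hypotheses (wP : is_gauss w) (cw : unzip1 c = w) (cf : tval f = x :: unzip2 c).

Lemma size_colors : size (unzip2 c) = size w.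
Proof. by rewrite -cw !size_map. Qed.

Lemma uniq_word : uniq (unzip1 c).
Proof. by rewrite cw; case/andP: wP. Qed.

Lemma beforeE e : e \in w -> before f e = nth x (x :: unzip2 c) (index e w).
Proof.
by move=> he; rewrite /before (tnth_nth x) cf inordK // ltnW // ltnS index_mem.
Qed.

Lemma afterE e : e \in w -> after f e = nth x (unzip2 c) (index e w).
Proof.
by move=> he; rewrite /after (tnth_nth x) cf inordK //= ltnS index_mem.
Qed.

Lemma labelled_strand L : labelled L x c ->
  forall e, e \in w -> (before f e, after f e) = strand_colors e (L e.1).
Proof.
move=> /(labelledP L x x uniq_word) h e he.
by rewrite -h ?cw // beforeE ?afterE.
Qed.

(** A labelling can only be the one computed from the colors; this is how
    labels are compared between two diagrams sharing a labelling. *)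
Lemma labelled_label L a : labelled L x c -> a \in arrows w ->
  label f a = L a.
Proof.
move=> h ha; have ht := arrows_mem _ wP ha.
have := labelled_strand h (ht true); have := labelled_strand h (ht false).
rewrite /label /strand_colors /head_of /tail_of /=; case: (L a) => u v.
by case: (positive a) => /= -[h1 h2] [h3 h4]; rewrite ?h1 ?h2 ?h3 ?h4.
Qed.

Lemma colored_by_strands a : (forall b,
    (before f (a, b), after f (a, b)) = strand_colors (a, b) (label f a)) <->
  colored_by f a (label f a).
Proof.
rewrite /colored_by; case: (label f a) => u v; rewrite /strand_colors /=.
split=> [h|h b].
  move: (h true) (h false); case: (positive a) => /= -[h1 h2] [h3 h4];
  by rewrite /head_of /tail_of h1 h2 h3 h4 !eqxx.
by move: h; case: (positive a) => /and4P[/eqP h1 /eqP h2 /eqP h3 /eqP h4];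
   case: b; rewrite -/(head_of a) -/(tail_of a) ?h1 ?h2 ?h3 ?h4.
Qed.

Lemma is_coloringP :
  is_coloring f <-> exit x c = x /\ exists L, labelled L x c.
Proof.
have -> : is_coloring f = (exit x c == x) &&
    all (fun a => colored_by f a (label f a)) (arrows w).
  rewrite /is_coloring !(tnth_nth x) cf /= -size_colors -last_nth.
  by rewrite eq_sym.
split=> [/andP[/eqP-> /allP h]|[-> [L hL]]].
  split=> //; exists (label f); apply/(labelledP _ _ x uniq_word) => e.
  rewrite cw => he.
  rewrite -beforeE // -afterE //.
  case: e he => a b he; apply: (colored_by_strands a).2.
  exact/h/(mem_arrows wP he).
rewrite eqxx /=; apply/allP => a ha; apply: (colored_by_strands a).1 => b.
by rewrite (labelled_label hL ha) -(labelled_strand hL) // arrows_mem.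
Qed.

End Word.

Lemma coloring_word (w : seq endpoint) (f : coloring X w) : is_gauss w ->
  exists x c L, [/\ unzip1 c = w, tval (val f) = x :: unzip2 c,
                    exit x c = x & labelled L x c].
Proof.
move=> wP; have := size_tuple (val f).
case E: (tval (val f)) => [|x ys] //= [sz]; exists x, (zip w ys).
have h1 : unzip1 (zip w ys) = w by rewrite unzip1_zip ?sz.
have h2 : unzip2 (zip w ys) = ys by rewrite unzip2_zip ?sz.
have [|h [L hL]] := (is_coloringP (x := x) wP h1 _).1 (valP f); rewrite h2 //.
by exists L.
Qed.

Lemma word_coloring (w : seq endpoint) x c L : is_gauss w ->
  unzip1 c = w -> exit x c = x -> labelled L x c ->
  exists f : coloring X w, tval (val f) = x :: unzip2 c.
Proof.
move=> wP cw hx hL.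
have sz : size (x :: unzip2 c) == (size w).+1 by rewrite /= -cw !size_map.
have fP : is_coloring (Tuple sz).
  by apply/(is_coloringP (x := x) (c := c) wP cw) => //; split=> //; exists L.
by exists (Sub _ fP).
Qed.

End Biquandle.

Arguments strand_colors : simpl never.

(** * Isomorphic quivers *)

Section Invariance.
Context {X : finBiquandle} {A : zmodType}.
Variables (W : (X * X) * (X * X) -> A) (S : {set endo X}).
Implicit Types (D : gaussDiagram) (w : seq endpoint).

Definition same_polynomials D D' : Prop :=
  indegree_polynomial (quiver W S D) = indegree_polynomial (quiver W S D') /\
  two_variable_polynomial (quiver W S D)
    = two_variable_polynomial (quiver W S D').

Lemma quiver_iso D D' (F : coloring X D -> coloring X D') : bijective F ->
  (forall f phi, F (act phi f) = act phi (F f)) ->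
  (forall f, Sigma W (F f) = Sigma W f) ->
  same_polynomials D D'.
Proof.
move=> Fbij Fact FSig.
pose E := (coloring X D * {phi : endo X | phi \in S})%type.
pose E' := (coloring X D' * {phi : endo X | phi \in S})%type.
pose FE (e : E) : E' := (F e.1, e.2).
have FEbij : bijective FE.
  by have [G FK GK] := Fbij; exists (fun e : E' => (G e.1, e.2)) => -[f phi];
     rewrite /FE /= ?FK ?GK.
split.
  rewrite /indegree_polynomial /= [RHS](reindex F) /=; last exact: onW_bij.
  apply: eq_bigr => f _; rewrite FSig; congr << (_, _) >>.
  rewrite /indegree /= -(card_imset _ (bij_inj FEbij)); apply: eq_card => e'.
  have [GE FK GK] := FEbij; rewrite -(GK e') mem_imset; last exact: bij_inj.
  by rewrite !inE /= -Fact (inj_eq (bij_inj Fbij)).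
rewrite /two_variable_polynomial /= [RHS](reindex FE) /=; last exact: onW_bij.
by apply: eq_bigr => -[f phi] _; rewrite /= -Fact !FSig.
Qed.

(** The bijection is given as a relation: the colors which change in a move
    are then described by what they satisfy, without choosing formulas. *)
Lemma same_polynomials_of_relation D D'
    (R : coloring X D -> coloring X D' -> Prop) :
  (forall f, exists f', R f f') -> (forall f', exists f, R f f') ->
  (forall f f1' f2', R f f1' -> R f f2' -> f1' = f2') ->
  (forall f1 f2 f', R f1 f' -> R f2 f' -> f1 = f2) ->
  (forall phi f f', R f f' -> R (act phi f) (act phi f')) ->
  (forall f f', R f f' -> Sigma W f = Sigma W f') ->
  same_polynomials D D'.
Proof.
move=> Rtot Rsurj Rfun Rinj Ract RSig.
have [F RF] := fin_all_exists Rtot; have [G RG] := fin_all_exists Rsurj.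
apply: (@quiver_iso _ _ F) => [|f phi|f].
- exists G => [f|f']; first exact: Rinj (RG _) (RF _).
  exact: Rfun (RF _) (RG _).
- exact: Rfun (RF _) (Ract _ _ _ (RF _)).
- by rewrite -(RSig _ _ (RF f)).
Qed.

(** * Homeomorphisms *)

(** [g] follows the arrows through a homeomorphism.  The sum only depends on
    signs, labels and [meets], which decides both crossing and order. *)
Lemma eq_Sigma w w' (g : arrow -> arrow) (f : coloring X w)
    (f' : coloring X w') :
  perm_eq (arrows w') [seq g a | a <- arrows w] ->
  {in arrows w, forall a, positive (g a) = positive a} ->
  {in arrows w, forall a, label (val f') (g a) = label (val f) a} ->
  {in arrows w &, injective g} ->
  (forall a e, a \in arrows w -> e \in w ->
     meets w' (g a) (g e.1, e.2) = meets w a e) ->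
  is_gauss w ->
  Sigma W f' = Sigma W f.
Proof.
move=> gw gpos glab ginj gmeets wP; rewrite /Sigma (perm_big _ gw) big_map.
apply: eq_big_seq => a ha; rewrite (perm_big _ gw) big_map.
rewrite big_seq_cond [RHS]big_seq_cond; apply: eq_big => b.
  apply: andb_id2l => hb; rewrite /crosses (inj_in_eq ginj) //.
  rewrite -[tail_of (g b)]/(g (b, false).1, (b, false).2).
  rewrite -[head_of (g b)]/(g (b, true).1, (b, true).2).
  by rewrite !gmeets ?arrows_mem.
by case/andP=> hb _; rewrite /sgn !gpos ?glab.
Qed.

(** Arcs of a cycle do not depend on the base point, so neither does [meets]. *)
Lemma meets_arc w a e :
  meets w a e = (e \in path.arc w (tail_of a) (head_of a)).
Proof. by rewrite /meets /path.arc in_take_leq ?index_size. Qed.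

Lemma arrows_map w (g : arrow -> arrow) :
  arrows [seq (g e.1, e.2) | e <- w] = [seq g a | a <- arrows w].
Proof. by rewrite /arrows filter_map -!map_comp. Qed.

Lemma same_polynomials_rot D D' k : gword D' = rot k D -> same_polynomials D D'.
Proof.
move=> eD'; pose R (f : coloring X D) (f' : coloring X D') :=
  exists x c1 c2, [/\ exit x (c1 ++ c2) = x, unzip1 c1 = take k D, unzip1 c2 = drop k D,
    tval (val f) = x :: unzip2 (c1 ++ c2)
    & tval (val f') = exit x c1 :: unzip2 (c2 ++ c1)].
have eD : drop k D ++ take k D = D' by rewrite eD'.
apply: (@same_polynomials_of_relation _ _ R).
- move=> f; have [x [c [L [cw cf hx hL]]]] := coloring_word f (gwordP D).
  have /unzip1_cat_inv [c1 [c2 [ec h1 h2]]] : unzip1 c = take k D ++ drop k D.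
    by rewrite cat_take_drop.
  have hxc : exit (exit x c1) c2 = x by rewrite -exit_cat -ec.
  have [] := @word_coloring X D' (exit x c1) (c2 ++ c1) L (gwordP D').
  + by rewrite /unzip1 map_cat -/(unzip1 c1) -/(unzip1 c2) h1 h2.
  + by rewrite exit_cat hxc.
  + by move: hL; rewrite ec !labelled_cat hxc andbC.
  by move=> f' cf'; exists f', x, c1, c2; split; rewrite // -ec.
- move=> f'; have [x [c [L [cw cf hx hL]]]] := coloring_word f' (gwordP D').
  have [c2 [c1 [ec h2 h1]]] : exists c1 c2, [/\ c = c1 ++ c2,
      unzip1 c1 = drop k D & unzip1 c2 = take k D].
    by apply: unzip1_cat_inv; rewrite eD.
  have hxc : exit (exit x c2) c1 = x by rewrite -exit_cat -ec.
  have [] := @word_coloring X D (exit x c2) (c1 ++ c2) L (gwordP D).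
  + by rewrite /unzip1 map_cat -/(unzip1 c1) -/(unzip1 c2) h1 h2 cat_take_drop.
  + by rewrite exit_cat hxc.
  + by move: hL; rewrite ec !labelled_cat hxc andbC.
  move=> f cf1; exists f, (exit x c2), c1, c2; split=> //.
    by rewrite exit_cat hxc.
  by rewrite hxc -ec.
- move=> f f1 f2 [x [c1 [c2 [hx h1 h2 hf hf1]]]] [y [d1 [d2 [kx k1 k2]]]].
  rewrite hf => -[<- e] hf2.
  have ec : c1 ++ c2 = d1 ++ d2.
    by apply: unzip_inj => //; rewrite /unzip1 !map_cat -!/(unzip1 _) h1 h2 k1 k2.
  have s1 : size c1 = size d1.
    by rewrite -(size_map fst c1) -/(unzip1 c1) h1 -k1 size_map.
  move/eqP: ec; rewrite eqseq_cat // => /andP[/eqP ec1 /eqP ec2].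
  by apply/val_inj/val_inj; rewrite /= hf1 hf2 ec1 ec2.
- move=> f1 f2 f [x [c1 [c2 [hx h1 h2 hf1 hf]]]] [y [d1 [d2 [kx k1 k2 hf2]]]].
  have s1 : size c2 = size d2.
    by rewrite -(size_map fst c2) -/(unzip1 c2) h2 -k2 size_map.
  rewrite hf => -[exy e].
  have ec : c2 ++ c1 = d2 ++ d1.
    by apply: unzip_inj => //; rewrite /unzip1 !map_cat -!/(unzip1 _) h1 h2 k1 k2.
  move/eqP: ec; rewrite eqseq_cat // => /andP[/eqP ec2 /eqP ec1].
  (* The first colors agree because the colors close up. *)
  apply/val_inj/val_inj; rewrite /= hf1 hf2 -kx -hx !exit_cat exy.
  by rewrite ec1 ec2.
- move=> phi f f' [x [c1 [c2 [hx h1 h2 hf hf']]]].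
  exists (val phi x), (recolor (val phi) c1), (recolor (val phi) c2).
  rewrite -map_cat !unzip1_recolor !exit_recolor hx; split=> //=.
    by rewrite hf unzip2_recolor.
  by rewrite hf' -map_cat unzip2_recolor.
- move=> f f' [x [c1 [c2 [hx h1 h2 hf hf']]]].
  have cw : unzip1 (c1 ++ c2) = D.
    by rewrite /unzip1 map_cat -!/(unzip1 _) h1 h2 cat_take_drop.
  have cw' : unzip1 (c2 ++ c1) = D'.
    by rewrite /unzip1 map_cat -!/(unzip1 _) h1 h2.
  have [_ [L hL]] := (is_coloringP (gwordP D) cw hf).1 (valP f).
  have hL' : labelled L (exit x c1) (c2 ++ c1).
    by move: hL; rewrite !labelled_cat -exit_cat hx andbC.
  have arr : arrows D' =i arrows D.
    by apply: perm_mem; rewrite eD' /arrows perm_map // perm_filter // perm_rot.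
  apply/esym/(@eq_Sigma _ _ id) => //.
  + by rewrite map_id eD' /arrows perm_map // perm_filter // perm_rot.
  + move=> a ha; rewrite (labelled_label (gwordP D') cw' hf' hL') ?arr //.
    by rewrite (labelled_label (gwordP D) cw hf hL).
  + move=> a [e b] ha _; rewrite !meets_arc eD' arc_rot ?(arrows_mem _ (gwordP D) ha) //.
    by case/andP: (gwordP D).
  + exact: gwordP.
Qed.

Lemma same_polynomials_rename D D' (g : arrow -> arrow) :
  {in arrows D &, injective g} ->
  {in arrows D, forall a, positive (g a) = positive a} ->
  gword D' = [seq (g e.1, e.2) | e <- D] -> same_polynomials D D'.
Proof.
move=> ginj gpos eD'; have DP := gwordP D; pose h (e : endpoint) := (g e.1, e.2).
have hinj : {in gword D &, injective h}.
  move=> [a b] [a' b'] ha ha' [] /ginj e <-.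
  by rewrite e //; [apply: (mem_arrows DP ha) | apply: (mem_arrows DP ha')].
have arr : arrows D' = map g (arrows D) by rewrite eD' arrows_map.
have sz : size D' = size D by rewrite eD' size_map.
have bef (f : (size D).+1.-tuple X) (f' : (size D').+1.-tuple X) e :
    tval f' = tval f -> e \in gword D ->
    before f' (h e) = before f e /\ after f' (h e) = after f e.
  move=> ff' he; rewrite /before /after !(tnth_nth (thead f)) ff'.
  have ie : index (h e) D' = index e D by rewrite eD' index_map_in.
  rewrite ie !inordK ?sz //= ltnS ?index_size // ?index_mem //.
have lab (f : (size D).+1.-tuple X) (f' : (size D').+1.-tuple X) a :
    tval f' = tval f -> a \in arrows D ->
    label f' (g a) = label f a /\
    (forall xy, colored_by f' (g a) xy = colored_by f a xy).
  move=> ff' ha.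
  have [bt at_] := bef f f' _ ff' (arrows_mem false DP ha).
  have [bh ah] := bef f f' _ ff' (arrows_mem true DP ha).
  rewrite /label /colored_by gpos // /head_of /tail_of.
  by rewrite -![(g a, _)]/(h (a, _)) bt at_ bh ah.
have col (f : (size D).+1.-tuple X) (f' : (size D').+1.-tuple X) :
    tval f' = tval f -> is_coloring f' = is_coloring f.
  move=> ff'; rewrite /is_coloring arr all_map !(tnth_nth (thead f)) ff' /= sz.
  congr (_ && _); apply: eq_in_all => a ha /=.
  by have [-> ->] := lab f f' a ff' ha.
apply: (@same_polynomials_of_relation _ _
          (fun f f' => tval (val f') = tval (val f))).
- move=> f; have sf : size (val f) == (size D').+1 by rewrite sz size_tuple.
  have fP : is_coloring (Tuple sf) by rewrite (col (val f)) ?(valP f).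
  by exists (Sub _ fP).
- move=> f; have sf : size (val f) == (size D).+1 by rewrite -sz size_tuple.
  have fP : is_coloring (Tuple sf) by rewrite -(col _ (val f)) ?(valP f).
  by exists (Sub _ fP).
- by move=> f f1 f2 e1 e2; apply/val_inj/val_inj; rewrite /= e1 e2.
- by move=> f1 f2 f e1 e2; apply/val_inj/val_inj; rewrite /= -e1 -e2.
- by move=> phi f f' /= ->.
- move=> f f' ff'; apply/esym/(@eq_Sigma _ _ g) => //.
  + by rewrite arr.
  + by move=> a ha; have [->] := lab _ _ a ff' ha.
  + move=> a e ha he; rewrite /meets eD'.
    rewrite -[tail_of (g a)]/(h (a, false)) -[head_of (g a)]/(h (a, true)).
    rewrite -/(h e) -/h index_map_in ?arrows_mem // -map_rot.
    by rewrite !index_map_in ?mem_rot ?arrows_mem //;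
       move=> u v; rewrite !mem_rot; apply: hinj.
Qed.

Lemma is_gauss_rot k w : is_gauss w -> is_gauss (rot k w).
Proof.
case/andP=> Uw /allP h; rewrite /is_gauss rot_uniq Uw /=.
by apply/allP => e; rewrite !mem_rot => /h.
Qed.

Lemma same_polynomials_homeo D D' : homeo D D' -> same_polynomials D D'.
Proof.
case=> k [g [ginj gpos eD']].
pose D1 := GaussDiagram (is_gauss_rot k (gwordP D)).
have [e1 e2] : same_polynomials D D1 by apply: (@same_polynomials_rot _ _ k).
rewrite /same_polynomials e1 e2 -/(same_polynomials D1 D').
have arr : arrows D1 =i arrows D.
  by apply: perm_mem; rewrite /arrows perm_map // perm_filter // perm_rot.
apply: (@same_polynomials_rename _ _ g) => // [a b|a]; rewrite !arr.
  exact: ginj.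
exact: gpos.
Qed.

(** * Replacing a tangle *)

Implicit Types (L : arrow -> X * X) (c d : seq (endpoint * X)).

(** The arcs of a tangle enter it with colors [x1], [x2], [x3] and the colored
    words [d1], [d2], [d3] satisfy the equations of [L].  Three arcs are enough
    for every move; smaller tangles get empty arcs. *)
Definition solution (s1 s2 s3 : seq endpoint) L x1 x2 x3 d1 d2 d3 : Prop :=
  [/\ unzip1 d1 = s1 /\ labelled L x1 d1, unzip1 d2 = s2 /\ labelled L x2 d2
    & unzip1 d3 = s3 /\ labelled L x3 d3].

(** The labelling may only change on arrows with both ends in the tangles,
    so that the equations outside are kept. *)
Definition transfers (s1 s2 s3 t1 t2 t3 : seq endpoint) : Prop :=
  forall L x1 x2 x3 d1 d2 d3, solution s1 s2 s3 L x1 x2 x3 d1 d2 d3 ->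
  exists L' d1' d2' d3', [/\ solution t1 t2 t3 L' x1 x2 x3 d1' d2' d3',
    exit x1 d1 = exit x1 d1', exit x2 d2 = exit x2 d2',
    exit x3 d3 = exit x3 d3'
    & forall e, e \notin (s1 ++ s2 ++ s3) ++ (t1 ++ t2 ++ t3) ->
        L' e.1 = L e.1].

(** The entry colors determine a solution; this makes the correspondence given
    by [transfers] one to one. *)
Definition rigid (s1 s2 s3 : seq endpoint) : Prop :=
  forall L L' x1 x2 x3 d1 d2 d3 d1' d2' d3',
  solution s1 s2 s3 L x1 x2 x3 d1 d2 d3 ->
  solution s1 s2 s3 L' x1 x2 x3 d1' d2' d3' ->
  [/\ d1 = d1', d2 = d2' & d3 = d3'].

Definition exchangeable (s1 s2 s3 t1 t2 t3 : seq endpoint) : Prop :=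
  [/\ transfers s1 s2 s3 t1 t2 t3, transfers t1 t2 t3 s1 s2 s3,
      rigid s1 s2 s3 & rigid t1 t2 t3].

(** [x2] and [x3] are the colors with which the second and third arcs are
    entered; they are the same on both sides because the exit colors are. *)
Inductive replaced (s1 s2 s3 t1 t2 t3 u v z : seq endpoint) (x : X) :
    seq (endpoint * X) -> seq (endpoint * X) -> Prop :=
  Replaced d1 d2 d3 d1' d2' d3' cu cv cz x2 x3 of
    unzip1 d1 = s1 & unzip1 d2 = s2 & unzip1 d3 = s3 &
    unzip1 d1' = t1 & unzip1 d2' = t2 & unzip1 d3' = t3 &
    unzip1 cu = u & unzip1 cv = v & unzip1 cz = z &
    x2 = exit (exit x d1) cu & x3 = exit (exit x2 d2) cv &
    exit x d1 = exit x d1' & exit x2 d2 = exit x2 d2' &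
    exit x3 d3 = exit x3 d3' :
  replaced s1 s2 s3 t1 t2 t3 u v z x
    (d1 ++ cu ++ d2 ++ cv ++ d3 ++ cz) (d1' ++ cu ++ d2' ++ cv ++ d3' ++ cz).

Section Replace.
Variables s1 s2 s3 t1 t2 t3 u v z : seq endpoint.
Let w := s1 ++ u ++ s2 ++ v ++ s3 ++ z.
Let w' := t1 ++ u ++ t2 ++ v ++ t3 ++ z.

Lemma replaced_sym x c c' : replaced s1 s2 s3 t1 t2 t3 u v z x c c' ->
  replaced t1 t2 t3 s1 s2 s3 u v z x c' c.
Proof.
case=> d1 d2 d3 d1' d2' d3' cu cv cz x2 x3 *.
by apply: (Replaced (x2 := x2) (x3 := x3)) => //; congruence.
Qed.

Lemma replaced_recolor phi x c c' :
  replaced s1 s2 s3 t1 t2 t3 u v z x c c' ->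
  replaced s1 s2 s3 t1 t2 t3 u v z (phi x) (recolor phi c) (recolor phi c').
Proof.
case=> d1 d2 d3 d1' d2' d3' cu cv cz x2 x3 *; rewrite /recolor !map_cat.
by apply: (Replaced (x2 := phi x2) (x3 := phi x3));
   rewrite ?unzip1_recolor // ?exit_recolor; congr phi.
Qed.

Lemma replaced_total L x c : transfers s1 s2 s3 t1 t2 t3 ->
  uniq w -> uniq w' -> unzip1 c = w -> exit x c = x -> labelled L x c ->
  exists L' c', [/\ replaced s1 s2 s3 t1 t2 t3 u v z x c c', unzip1 c' = w',
                    exit x c' = x & labelled L' x c'].
Proof.
move=> T Uw Uw' /unzip1_cat_inv[d1 [c1 [-> h1]]].
move=> /unzip1_cat_inv[cu [c2 [-> hu]]] /unzip1_cat_inv[d2 [c3 [-> h2]]].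
move=> /unzip1_cat_inv[cv [c4 [-> hv]]] /unzip1_cat_inv[d3 [cz [-> h3 hz]]].
set x2 := exit (exit x d1) cu; set x3 := exit (exit x2 d2) cv.
rewrite !labelled_cat !exit_cat -/x2 -/x3 => hx.
case/and5P=> L1 Lu L2 Lv /andP[L3 Lz].
have [L' [d1' [d2' [d3' [[[k1 M1] [k2 M2] [k3 M3]] e1 e2 e3 eL]]]]] :=
  T L x x2 x3 d1 d2 d3 (And3 (conj h1 L1) (conj h2 L2) (conj h3 L3)).
exists L', (d1' ++ cu ++ d2' ++ cv ++ d3' ++ cz); split.
- exact: (Replaced (x2 := x2) (x3 := x3)).
- by rewrite /unzip1 !map_cat -!/(unzip1 _) k1 k2 k3 hu hv hz.
- by rewrite !exit_cat -e1 -/x2 -e2 -/x3 -e3.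
(* An endpoint outside the arcs belongs to neither tangle, since no endpoint
   occurs twice in [w] or in [w']. *)
have out c0 y :
    {subset unzip1 c0 <= u ++ v ++ z} -> labelled L' y c0 = labelled L y c0.
  move=> sub; apply: eq_labelled => e /sub he; apply: eL.
  apply/negP; rewrite mem_cat => /orP[] he'.
    have : uniq ((s1 ++ s2 ++ s3) ++ (u ++ v ++ z)).
      by rewrite (perm_uniq (perm_gather _ _ _ _ _ _)).
    by rewrite cat_uniq => /and3P[_ /hasPn /(_ e he) /negP].
  have : uniq ((t1 ++ t2 ++ t3) ++ (u ++ v ++ z)).
    by rewrite (perm_uniq (perm_gather _ _ _ _ _ _)).
  by rewrite cat_uniq => /and3P[_ /hasPn /(_ e he) /negP].
rewrite !labelled_cat -e1 -/x2 -e2 -/x3 -e3 M1 M2 M3 !out ?Lu ?Lv ?Lz //.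
- by move=> e; rewrite hz !mem_cat => ->; rewrite !orbT.
- by move=> e; rewrite hv !mem_cat => ->; rewrite !orbT.
- by move=> e; rewrite hu !mem_cat => ->.
Qed.

Lemma cat_colors_inj c c' d d' : unzip1 c = unzip1 c' ->
  c ++ d = c' ++ d' -> c = c' /\ d = d'.
Proof.
move=> e /eqP; rewrite eqseq_cat; first by case/andP=> /eqP-> /eqP->.
by rewrite -(size_map fst c) -/(unzip1 c) e size_map.
Qed.

Lemma replaced_functional L L' x c c1 c2 : rigid t1 t2 t3 ->
  replaced s1 s2 s3 t1 t2 t3 u v z x c c1 ->
  replaced s1 s2 s3 t1 t2 t3 u v z x c c2 ->
  labelled L x c1 -> labelled L' x c2 -> c1 = c2.
Proof.
move=> T; case=> d1 d2 d3 d1' d2' d3' cu cv cz x2 x3 h1 h2 h3 h1' h2' h3'.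
move=> hu hv hz ex2 ex3 E1 E2 E3; move ec: (d1 ++ _) => c' R.
case: R ec => f1 f2 f3 f1' f2' f3' bu bv bz y2 y3 k1 k2 k3 k1' k2' k3'.
move=> ku kv kz ey2 ey3 F1 F2 F3.
have inj c0 c0' d0 d0' s : unzip1 c0 = s -> unzip1 c0' = s ->
    c0 ++ d0 = c0' ++ d0' -> c0 = c0' /\ d0 = d0'.
  by move=> <- e; apply: cat_colors_inj.
case/(inj _ _ _ _ _ h1 k1)=> ?; case/(inj _ _ _ _ _ hu ku)=> ?.
case/(inj _ _ _ _ _ h2 k2)=> ?; case/(inj _ _ _ _ _ hv kv)=> ?.
case/(inj _ _ _ _ _ h3 k3)=> ? ?; subst f1 bu f2 bv f3 bz.
rewrite -ex2 in ey2; rewrite ey2 -ex3 in ey3 F2; rewrite ey3 in F3.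
rewrite !labelled_cat -!E1 -!F1 -!ex2 -!E2 -!F2 -!ex3.
case/and5P=> L1 Lu L2 Lv /andP[L3 Lz]; case/and5P=> M1 Mu M2 Mv /andP[M3 Mz].
have [-> -> ->] // := T L L' x x2 x3 d1' d2' d3' f1' f2' f3'
 (And3 (conj h1' L1) (conj h2' L2) (conj h3' L3))
 (And3 (conj k1' M1) (conj k2' M2) (conj k3' M3)).
Qed.

End Replace.

Lemma replaced_words s1 s2 s3 t1 t2 t3 u v z x c c' :
  replaced s1 s2 s3 t1 t2 t3 u v z x c c' ->
  unzip1 c = s1 ++ u ++ s2 ++ v ++ s3 ++ z /\
  unzip1 c' = t1 ++ u ++ t2 ++ v ++ t3 ++ z.
Proof.
case=> d1 d2 d3 d1' d2' d3' cu cv cz x2 x3 h1 h2 h3 h1' h2' h3' hu hv hz *.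
rewrite /unzip1 !map_cat -!/(unzip1 _).
by rewrite h1 h2 h3 h1' h2' h3' hu hv hz.
Qed.

(** A coloring is made of solutions in the arcs and of colors outside, so the
    local exchange gives a bijection between all colorings.  The last hypothesis
    says that it relates them by colored moves, to which [arrow_weight] applies. *)
Lemma same_polynomials_replace D D' s1 s2 s3 t1 t2 t3 u v z :
  arrow_weight W ->
  gword D = s1 ++ u ++ s2 ++ v ++ s3 ++ z ->
  gword D' = t1 ++ u ++ t2 ++ v ++ t3 ++ z ->
  exchangeable s1 s2 s3 t1 t2 t3 ->
  (forall x c c', replaced s1 s2 s3 t1 t2 t3 u v z x c c' ->
     colored_rmove x c c') ->
  same_polynomials D D'.
Proof.
move=> hW eD eD' [T T' rs rt] rm.
have [Uw _] := andP (gwordP D); have [Uw' _] := andP (gwordP D').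
rewrite eD in Uw; rewrite eD' in Uw'.
pose R (f : coloring X D) (f' : coloring X D') := exists x c c',
  [/\ replaced s1 s2 s3 t1 t2 t3 u v z x c c', tval (val f) = x :: unzip2 c
    & tval (val f') = x :: unzip2 c'].
apply: (@same_polynomials_of_relation _ _ R).
- move=> f; have [x [c [L [cw cf hx hL]]]] := coloring_word f (gwordP D).
  rewrite eD in cw.
  have [L' [c' [rc cw' hx' hL']]] := replaced_total T Uw Uw' cw hx hL.
  rewrite -eD' in cw'.
  have [f' cf'] := word_coloring (gwordP D') cw' hx' hL'.
  by exists f', x, c, c'.
- move=> f'; have [x [c' [L [cw' cf' hx hL]]]] := coloring_word f' (gwordP D').
  rewrite eD' in cw'.
  have [L' [c [rc cw hx' hL']]] := replaced_total T' Uw' Uw cw' hx hL.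
  rewrite -eD in cw.
  have [f cf] := word_coloring (gwordP D) cw hx' hL'.
  by exists f, x, c, c'; split=> //; apply: replaced_sym.
- move=> f f1 f2 [x [c [c1 [r1 ef ef1]]]] [y [d [c2 [r2]]]].
  rewrite ef => -[exy ecd] ef2; subst y.
  have [w1 w1'] := replaced_words r1; have [w2 w2'] := replaced_words r2.
  have ? : c = d by apply: unzip_inj; rewrite ?w1.
  subst d; rewrite -eD' in w1' w2'.
  have [_ [L1 hL1]] := (is_coloringP (gwordP D') w1' ef1).1 (valP f1).
  have [_ [L2 hL2]] := (is_coloringP (gwordP D') w2' ef2).1 (valP f2).
  apply/val_inj/val_inj; rewrite /= ef1 ef2.
  by rewrite (replaced_functional rt r1 r2 hL1 hL2).
- move=> f1 f2 f [x [c1 [c [/replaced_sym r1 ef1 ef]]]].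
  move=> [y [c2 [d [/replaced_sym r2 ef2]]]].
  rewrite ef => -[exy ecd]; subst y.
  have [w1 w1'] := replaced_words r1; have [w2 w2'] := replaced_words r2.
  have ? : c = d by apply: unzip_inj; rewrite ?w1.
  subst d; rewrite -eD in w1' w2'.
  have [_ [L1 hL1]] := (is_coloringP (gwordP D) w1' ef1).1 (valP f1).
  have [_ [L2 hL2]] := (is_coloringP (gwordP D) w2' ef2).1 (valP f2).
  apply/val_inj/val_inj; rewrite /= ef1 ef2.
  by rewrite (replaced_functional rs r1 r2 hL1 hL2).
- move=> phi f f' [x [c [c' [r ef ef']]]].
  exists (val phi x), (recolor (val phi) c), (recolor (val phi) c').
  by rewrite !unzip2_recolor /= ef ef'; split=> //; apply: replaced_recolor.
- move=> f f' [x [c [c' [r ef ef']]]]; apply: hW; exists x, c, c'.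
  have [cw cw'] := replaced_words r.
  by split; rewrite ?cw ?cw' //; apply: rm.
Qed.

(** * Reidemeister moves *)

Lemma colors2 e e' d : unzip1 d = [:: e; e'] ->
  exists y y', d = [:: (e, y); (e', y')].
Proof. by case: d => [|[? y] [|[? y'] [|//]]] //= [-> ->]; exists y, y'. Qed.

Lemma colors0 d : unzip1 d = [::] -> d = [::].
Proof. by case: d. Qed.

(** An endpoint which avoids both ends of [a] belongs to another arrow. *)
Lemma off_arrow (s : seq endpoint) a e :
  (a, true) \in s -> (a, false) \in s -> e \notin s -> (e.1 == a) = false.
Proof.
by move=> h h'; case: e => c [] /=; apply: contraNF => /eqP ->.
Qed.

(** The two cyclic orders of move III only differ by the order of two arcs. *)
Lemma exchangeable_swap s1 s2 s3 t1 t2 t3 :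
  exchangeable s1 s2 s3 t1 t2 t3 -> exchangeable s1 s3 s2 t1 t3 t2.
Proof.
have T u1 u2 u3 v1 v2 v3 :
    transfers u1 u2 u3 v1 v2 v3 -> transfers u1 u3 u2 v1 v3 v2.
  move=> T L x1 x2 x3 d1 d2 d3 [h1 h2 h3].
  have [L' [d1' [d2' [d3' [[k1 k2 k3] e1 e2 e3 eL]]]]] :=
    T L x1 x3 x2 d1 d3 d2 (And3 h1 h3 h2).
  exists L', d1', d3', d2'; split=> // e he; apply: eL.
  by move: he; rewrite !mem_cat !negb_or -!andbA => /and5P[-> -> -> -> /andP[-> ->]].
have G u1 u2 u3 : rigid u1 u2 u3 -> rigid u1 u3 u2.
  move=> G L L' x1 x2 x3 d1 d2 d3 d1' d2' d3' [h1 h2 h3] [h1' h2' h3'].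
  by have [] := G L L' x1 x3 x2 _ _ _ _ _ _ (And3 h1 h3 h2) (And3 h1' h3' h2').
by case=> T1 T2 G1 G2; split; [apply: T | apply: T | apply: G | apply: G].
Qed.

Lemma rigid_nil : rigid [::] [::] [::].
Proof.
move=> L L' x1 x2 x3 d1 d2 d3 d1' d2' d3' [[/colors0-> _] [/colors0-> _]].
move=> [/colors0-> _] [[/colors0-> _] [/colors0-> _] [/colors0-> _]].
by split.
Qed.

(** The label is diagonal, and at a diagonal label the two ends of the arrow
    have opposite pairs of colors: the strand leaves with its entry color. *)
Lemma kink_colors a b L x y y' :
  labelled L x [:: ((a, b), y); ((a, ~~ b), y')] ->
  y' = x /\
  exists k, (strand_colors (a, b) (k, k)).1 = x
         /\ (strand_colors (a, b) (k, k)).2 = y.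
Proof.
rewrite /= andbT => /andP[/eqP e1 /eqP e2].
have /kink_label : (strand_colors (a, b) (L a)).2
                   = (strand_colors (a, ~~ b) (L a)).1 by rewrite -e1 -e2.
case: (L a) e1 e2 => k k' /= e1 e2 ek; subst k'.
move: e2; rewrite kink_diag -e1 => -[->]; split=> //.
by exists k; rewrite -e1.
Qed.

Lemma exchangeable_kink a b :
  exchangeable [:: (a, b); (a, ~~ b)] [::] [::] [::] [::] [::].
Proof.
split; last exact: rigid_nil.
- move=> L x1 x2 x3 d1 d2 d3 [[/colors2[y [y' ->]] h]].
  move=> [/colors0-> _] [/colors0-> _].
  by have [-> _] := kink_colors h; exists L, [::], [::], [::]; split.
- move=> L x1 x2 x3 d1 d2 d3 [[/colors0-> _] [/colors0-> _] [/colors0-> _]].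
  have [k _ kK] := @kink_entry_bij X (a, b).
  pose l := (k x1, k x1); pose y := (strand_colors (a, b) l).2.
  have el : strand_colors (a, b) l = (x1, y).
    by rewrite -(kK x1) -surjective_pairing.
  exists [eta L with a |-> l], [:: ((a, b), y); ((a, ~~ b), x1)], [::], [::].
  split=> //; first by split; rewrite //= eqxx /l kink_diag -/l el !eqxx.
  by move=> e he /=; rewrite (off_arrow _ _ he) // !inE; case: (b); rewrite eqxx ?orbT.
- move=> L L' x1 x2 x3 d1 d2 d3 d1' d2' d3'.
  move=> [[/colors2[y [y' ->]] h] [/colors0-> _] [/colors0-> _]].
  move=> [[/colors2[m [m' ->]] h'] [/colors0-> _] [/colors0-> _]].
  have [-> [k [ek <-]]] := kink_colors h; have [-> [n [en <-]]] := kink_colors h'.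
  by rewrite -ek in en; rewrite (bij_inj (kink_entry_bij _) en).
Qed.

Section Bigon.
Variables a a' b b' : arrow.
Hypotheses (signs_a : positive a' = ~~ positive a)
  (signs_b : positive b' = ~~ positive b)
  (same_arrows : b = a /\ b' = a' \/ b = a' /\ b' = a).

Lemma tail_opp (l : X * X) : strand_colors (tail_of a') l =
  ((strand_colors (tail_of a) l).2, (strand_colors (tail_of a) l).1).
Proof. exact: strand_colors_opp. Qed.

Lemma head_opp (l : X * X) : strand_colors (head_of b') l =
  ((strand_colors (head_of b) l).2, (strand_colors (head_of b) l).1).
Proof. exact: strand_colors_opp. Qed.

(** The two arrows share the colors of the inner pieces, which determine a
    label, so they have the same label; signs being opposite, each strand then
    leaves with its entry color. *)
Lemma bigon_colors L x1 x2 y1 y2 z1 z2 :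
  labelled L x1 [:: (tail_of a, y1); (tail_of a', z1)] ->
  labelled L x2 [:: (head_of b, y2); (head_of b', z2)] ->
  [/\ z1 = x1, z2 = x2
    & exists l, strand_colors (tail_of a) l = (x1, y1) /\
                strand_colors (head_of b) l = (x2, y2)].
Proof.
rewrite /= !andbT => /andP[/eqP e1 /eqP e2] /andP[/eqP e3 /eqP e4].
have ll : L a = L a'.
  (* The inner pieces are those entering [a'] at its tail and [b'] at its head. *)
  apply: (bij_inj (entry_colors_bij a' b')); rewrite -e2 tail_opp -e1 /=.
  congr (_, _); suff: (strand_colors (head_of b') (L b)).1 =
                      (strand_colors (head_of b') (L b')).1.
    by case: same_arrows => -[-> ->].
  by rewrite -e4 head_opp -e3.
have lb : L b = L a by case: same_arrows => -[-> _].
have lb' : L b' = L a by case: same_arrows => -[_ ->].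
move: e4; rewrite lb' -lb head_opp -e3 => -[->].
move: e2; rewrite -ll tail_opp -e1 => -[->].
by split=> //; exists (L a); rewrite -{2}lb.
Qed.

Lemma exchangeable_bigon :
  exchangeable [:: tail_of a; tail_of a'] [:: head_of b; head_of b'] [::]
    [::] [::] [::].
Proof.
split; last exact: rigid_nil.
- move=> L x1 x2 x3 d1 d2 d3.
  move=> [[/colors2[y1 [z1 ->]] h1] [/colors2[y2 [z2 ->]] h2] [/colors0-> _]].
  by have [-> -> _] := bigon_colors h1 h2; exists L, [::], [::], [::]; split.
- move=> L x1 x2 x3 d1 d2 d3 [[/colors0-> _] [/colors0-> _] [/colors0-> _]].
  have [k _ kK] := @entry_colors_bij X a b.
  pose l := k (x1, x2); have [ex1 ex2] := kK (x1, x2); rewrite -/l in ex1 ex2.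
  have [L' lb eL] : exists2 L', forall n, n \in [:: a; a'] -> L' n = l
                             & forall n, n \notin [:: a; a'] -> L' n = L n.
    exists [eta L with a |-> l, a' |-> l] => n /=; rewrite !inE;
    by case: (n == a); case: (n == a').
  have [ha ha'] : a \in [:: a; a'] /\ a' \in [:: a; a'].
    by rewrite !inE !eqxx orbT.
  have [hb hb'] : b \in [:: a; a'] /\ b' \in [:: a; a'].
    by rewrite !inE; case: same_arrows => -[-> ->]; rewrite !eqxx ?orbT.
  exists L',
    [:: (tail_of a, (strand_colors (tail_of a) l).2); (tail_of a', x1)],
    [:: (head_of b, (strand_colors (head_of b) l).2); (head_of b', x2)], [::].
  split=> //.
    split=> //; split=> //=; rewrite !lb //.
      by rewrite tail_opp ex1 -{1}ex1 -surjective_pairing !eqxx.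
    by rewrite head_opp ex2 -{1}ex2 -surjective_pairing !eqxx.
  move=> e he; apply: eL; rewrite !inE !(off_arrow _ _ he) //; rewrite !inE;
  by case: same_arrows => -[-> ->]; rewrite eqxx ?orbT.
- move=> L L' x1 x2 x3 d1 d2 d3 d1' d2' d3'.
  move=> [[/colors2[y1 [z1 ->]] h1] [/colors2[y2 [z2 ->]] h2] [/colors0-> _]].
  move=> [[/colors2[m1 [n1 ->]] k1] [/colors2[m2 [n2 ->]] k2] [/colors0-> _]].
  have [-> -> [l [e1 e2]]] := bigon_colors h1 h2.
  have [-> -> [l' [e1' e2']]] := bigon_colors k1 k2.
  have e : l = l' by apply: (bij_inj (entry_colors_bij a b)); rewrite e1 e2 e1' e2'.
  by subst l'; move: e1' e2'; rewrite e1 e2 => -[<-] [<-].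
Qed.

End Bigon.

Section Triangle.
Variables p q r : arrow.
Hypotheses (pp : positive p) (pq : positive q) (pr : positive r).
Hypotheses (neq_pq : p != q) (neq_pr : p != r) (neq_qr : q != r).

Lemma strand_head_pos a (x y : X) : positive a ->
  strand_colors (head_of a) (x, y) = (x, x \_> y).
Proof. by rewrite /strand_colors /= => ->. Qed.

Lemma strand_tail_pos a (x y : X) : positive a ->
  strand_colors (tail_of a) (x, y) = (y \^> x, y).
Proof. by rewrite /strand_colors /= => ->. Qed.

(** Eliminating the labels: at a positive arrow, the label consists of the
    colors before its head and after its tail. *)
Lemma triangle_colorsP L (x y z y1 y2 y3 z1 z2 z3 : X) :
  labelled L x [:: (head_of p, y1); (head_of q, z1)] ->
  labelled L y [:: (tail_of p, y2); (head_of r, z2)] ->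
  labelled L z [:: (tail_of q, y3); (tail_of r, z3)] ->
  [/\ y1 = x \_> y2, y = y2 \^> x, z2 = y2 \_> z3, y3 = z3 \^> y2
    & z1 = y1 \_> y3 /\ z = y3 \^> y1].
Proof.
rewrite /= !andbT; case: (L p) (L q) (L r) => [a b] [a' b'] [a'' b''].
rewrite !(strand_head_pos _ _ pp, strand_head_pos _ _ pq, strand_head_pos _ _ pr,
  strand_tail_pos _ _ pp, strand_tail_pos _ _ pq, strand_tail_pos _ _ pr).
by do 3![case/andP=> /eqP[? ?] /eqP[? ?]]; subst.
Qed.

Lemma triangle_colorsP' L (x y z y1 y2 y3 z1 z2 z3 : X) :
  labelled L x [:: (head_of q, y1); (head_of p, z1)] ->
  labelled L y [:: (head_of r, y2); (tail_of p, z2)] ->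
  labelled L z [:: (tail_of r, y3); (tail_of q, z3)] ->
  [/\ y1 = x \_> z3, y3 = z3 \^> x, y2 = y \_> y3, z = y3 \^> y
    & z1 = y1 \_> z2 /\ y2 = z2 \^> y1].
Proof.
rewrite /= !andbT; case: (L p) (L q) (L r) => [a b] [a' b'] [a'' b''].
rewrite !(strand_head_pos _ _ pp, strand_head_pos _ _ pq, strand_head_pos _ _ pr,
  strand_tail_pos _ _ pp, strand_tail_pos _ _ pq, strand_tail_pos _ _ pr).
by do 3![case/andP=> /eqP[? ?] /eqP[? ?]]; subst.
Qed.

Definition relabel (L : arrow -> X * X) lp lq lr : arrow -> X * X :=
  [eta L with p |-> lp, q |-> lq, r |-> lr].

Lemma relabelE L lp lq lr :
  [/\ relabel L lp lq lr p = lp, relabel L lp lq lr q = lq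
    & relabel L lp lq lr r = lr].
Proof.
rewrite /relabel /= !eqxx (eq_sym q p) (eq_sym r p) (eq_sym r q).
by rewrite (negbTE neq_pq) (negbTE neq_pr) (negbTE neq_qr).
Qed.

(** With [y = t \^> x], both sides are expressed by the entry color [x] of the
    first arc, the exit color [z3] of the third one and [t].  The three exchange
    laws say that the two sides agree on the exit color of the first arc and on
    the entry color of the third, and that the two crossings met by the second
    arc after the move agree on the color of the piece between them. *)
Lemma exchangeable_triangle :
  exchangeable
    [:: head_of p; head_of q] [:: tail_of p; head_of r] [:: tail_of q; tail_of r]
    [:: head_of q; head_of p] [:: head_of r; tail_of p] [:: tail_of r; tail_of q].
Proof.
have pos := (strand_head_pos _ _ pp, strand_head_pos _ _ pq,
  strand_head_pos _ _ pr, strand_tail_pos _ _ pp, strand_tail_pos _ _ pq,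
  strand_tail_pos _ _ pr).
have off L lp lq lr (s : seq endpoint) e : e \notin s ->
    {subset [:: head_of p; tail_of p; head_of q; tail_of q; head_of r;
                tail_of r] <= s} -> relabel L lp lq lr e.1 = L e.1.
  move=> he sub; rewrite /relabel /= !(off_arrow _ _ he) //;
  by apply: sub; rewrite !inE eqxx ?orbT.
split.
- move=> L x y z d1 d2 d3 [[/colors2[y1 [z1 ->]] h1]].
  move=> [/colors2[y2 [z2 ->]] h2] [/colors2[y3 [z3 ->]] h3].
  have [? ? ? ? [? ?]] := triangle_colorsP h1 h2 h3; subst.
  set L' := relabel L (x \_> z3, y2 \_> z3) (x, z3) (y2 \^> x, z3 \^> x).
  have [Lp Lq Lr] := relabelE L (x \_> z3, y2 \_> z3) (x, z3)
    (y2 \^> x, z3 \^> x); rewrite -/L' in Lp Lq Lr.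
  exists L', [:: (head_of q, x \_> z3); (head_of p, (x \_> y2) \_> (z3 \^> y2))],
    [:: (head_of r, (y2 \^> x) \_> (z3 \^> x)); (tail_of p, y2 \_> z3)],
    [:: (tail_of r, z3 \^> x); (tail_of q, z3)].
  split=> //.
    split; split; rewrite //= ?Lp ?Lq ?Lr !pos ?eqxx //=.
    + by rewrite (bq_exch1 (bqP X)) !eqxx.
    + by rewrite (bq_exch2 (bqP X)) !eqxx.
    + by rewrite (bq_exch3 (bqP X)) !eqxx.
  by move=> e he; apply: (off _ _ _ _ _ _ he) => e'; rewrite !inE;
     do ?[case/orP]; move=> ->; rewrite ?orbT.
- move=> L x y z d1 d2 d3 [[/colors2[y1 [z1 ->]] h1]].
  move=> [/colors2[y2 [z2 ->]] h2] [/colors2[y3 [z3 ->]] h3].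
  have [? ? ? ? [? e2]] := triangle_colorsP' h1 h2 h3; subst.
  (* [t] is the new color of the middle piece of the second arc. *)
  have [t et] : exists t : X, t \^> x = y.
    by have [k _ kK] := bq_ovr_bij (bqP X) x; exists (k y); apply: kK.
  have ez2 : z2 = t \_> z3.
    by apply: (@ovr_inj X (x \_> z3)); rewrite -e2 (bq_exch2 (bqP X)) et.
  subst y z2; set L' := relabel L (x, t) (x \_> t, z3 \^> t) (t, z3).
  have [Lp Lq Lr] := relabelE L (x, t) (x \_> t, z3 \^> t) (t, z3).
  rewrite -/L' in Lp Lq Lr.
  exists L', [:: (head_of p, x \_> t); (head_of q, (x \_> t) \_> (z3 \^> t))],
    [:: (tail_of p, t); (head_of r, t \_> z3)],
    [:: (tail_of q, z3 \^> t); (tail_of r, z3)].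
  split=> //.
  + by split; split; rewrite //= ?Lp ?Lq ?Lr !pos ?eqxx //= ?andbT
      -(bq_exch3 (bqP X)).
  + by rewrite /exit /= (bq_exch1 (bqP X)).
  by move=> e he; apply: (off _ _ _ _ _ _ he) => e'; rewrite !inE;
     do ?[case/orP]; move=> ->; rewrite ?orbT.
- move=> L L' x y z d1 d2 d3 d1' d2' d3'.
  move=> [[/colors2[y1 [z1 ->]] h1] [/colors2[y2 [z2 ->]] h2]].
  move=> [/colors2[y3 [z3 ->]] h3] [[/colors2[m1 [n1 ->]] k1]].
  move=> [/colors2[m2 [n2 ->]] k2] [/colors2[m3 [n3 ->]] k3].
  have [ey1 ey ez2 ey3 [ez1 ez]] := triangle_colorsP h1 h2 h3.
  have [em1 em en2 em3 [en1 en]] := triangle_colorsP k1 k2 k3.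
  have e2 : y2 = m2 by apply: (@ovr_inj X x); rewrite -ey -em.
  have e1 : y1 = m1 by rewrite ey1 em1 e2.
  have e3 : y3 = m3 by apply: (@ovr_inj X y1); rewrite -ez e1 -en.
  have e4 : z3 = n3 by apply: (@ovr_inj X y2); rewrite -ey3 e2 -em3 e3.
  by rewrite ez1 en1 ez2 en2 e1 e2 e3 e4.
- move=> L L' x y z d1 d2 d3 d1' d2' d3'.
  move=> [[/colors2[y1 [z1 ->]] h1] [/colors2[y2 [z2 ->]] h2]].
  move=> [/colors2[y3 [z3 ->]] h3] [[/colors2[m1 [n1 ->]] k1]].
  move=> [/colors2[m2 [n2 ->]] k2] [/colors2[m3 [n3 ->]] k3].
  have [ey1 ey3 ey2 ez [ez1 ey2']] := triangle_colorsP' h1 h2 h3.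
  have [em1 em3 em2 en [en1 em2']] := triangle_colorsP' k1 k2 k3.
  have e3 : y3 = m3 by apply: (@ovr_inj X y); rewrite -ez -en.
  have e4 : z3 = n3 by apply: (@ovr_inj X x); rewrite -ey3 -em3 e3.
  have e1 : y1 = m1 by rewrite ey1 em1 e4.
  have e2 : y2 = m2 by rewrite ey2 em2 e3.
  have e5 : z2 = n2 by apply: (@ovr_inj X y1); rewrite -ey2' e2 em2' e1.
  by rewrite ez1 en1 e1 e2 e3 e4 e5.
Qed.

End Triangle.

Lemma same_polynomials_move D D' :
  arrow_weight W -> rmove D D' -> same_polynomials D D'.
Proof.
move=> hW; move eD: (gword D) => w; move eD': (gword D') => w' m.
case: m eD eD' => [a b v|a a' s t u v sg /perm_eq_pair ps /perm_eq_pair pt|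
  p q r u v z pp pq pr|p q r u v z pp pq pr] eD eD'.
- apply: (@same_polynomials_replace _ _ _ _ _ _ _ _ v [::] [::] hW _ _
    (exchangeable_kink a b)); rewrite ?cats0 //.
  move=> x c c' [d1 d2 d3 d1' d2' d3' cu cv cz x2 x3].
  move=> /colors2[y [y' ->]] /colors0-> /colors0-> /colors0-> /colors0->.
  move=> /colors0-> _ /colors0-> /colors0-> _ _ ey _ _; rewrite !cats0.
  by have -> : y' = x := ey; apply: CRMove1.
- have [e [e' [es ee]]] : exists e e', s = [:: tail_of e; tail_of e'] /\
      (e = a /\ e' = a' \/ e = a' /\ e' = a).
    by case: ps => ->; [exists a, a' | exists a', a]; split; auto.
  have [o [o' [et oo]]] : exists o o', t = [:: head_of o; head_of o'] /\
      (o = a /\ o' = a' \/ o = a' /\ o' = a).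
    by case: pt => ->; [exists a, a' | exists a', a]; split; auto.
  have se : positive e' = ~~ positive e.
    by case: ee => -[-> ->]; rewrite sg ?negbK.
  have so : positive o' = ~~ positive o.
    by case: oo => -[-> ->]; rewrite sg ?negbK.
  have same : o = e /\ o' = e' \/ o = e' /\ o' = e.
    by case: ee => -[-> ->]; case: oo => -[-> ->]; auto.
  subst s t; apply: (@same_polynomials_replace _ _ _ _ _ _ _ _ u v [::] hW _ _
    (exchangeable_bigon se so same)); rewrite ?cats0 //.
  move=> x c c' [d1 d2 d3 d1' d2' d3' cu cv cz x2 x3].
  move=> /colors2[y [y' ->]] /colors2[m [n ->]] /colors0-> /colors0->.
  move=> /colors0-> /colors0-> _ _ /colors0-> e2 _ ey en _.
  have ? : y' = x := ey; have ? : n = x2 := en; subst y' n.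
  rewrite !cats0; apply: CRMove2 se _ _ _ => //.
  by case: same => -[-> ->] //; rewrite (perm_catC [:: _]).
- have [npq npr nqr] : [/\ p != q, p != r & q != r].
    have [] := andP (gwordP D); rewrite eD => Uw _; split; apply: contraL Uw;
    by move=> /eqP->; rewrite /= !(mem_cat, inE, eqxx, orbT, andbF).
  apply: (@same_polynomials_replace _ _ _ _ _ _ _ _ u v z hW eD eD'
    (exchangeable_triangle pp pq pr npq npr nqr)).
  move=> x c c' [d1 d2 d3 d1' d2' d3' cu cv cz x2 x3].
  move=> /colors2[y1 [z1 ->]] /colors2[y2 [z2 ->]] /colors2[y3 [z3 ->]].
  move=> /colors2[m1 [n1 ->]] /colors2[m2 [n2 ->]] /colors2[m3 [n3 ->]].
  move=> _ _ _ _ _ e1 e2 e3; have ? : z1 = n1 := e1.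
  have ? : z2 = n2 := e2; have ? : z3 = n3 := e3; subst n1 n2 n3.
  exact: CRMove3.
- have [npq npr nqr] : [/\ p != q, p != r & q != r].
    have [] := andP (gwordP D); rewrite eD => Uw _; split; apply: contraL Uw;
    by move=> /eqP->; rewrite /= !(mem_cat, inE, eqxx, orbT, andbF).
  apply: (@same_polynomials_replace _ _ _ _ _ _ _ _ u v z hW eD eD'
    (exchangeable_swap (exchangeable_triangle pp pq pr npq npr nqr))).
  move=> x c c' [d1 d2 d3 d1' d2' d3' cu cv cz x2 x3].
  move=> /colors2[y1 [z1 ->]] /colors2[y2 [z2 ->]] /colors2[y3 [z3 ->]].
  move=> /colors2[m1 [n1 ->]] /colors2[m2 [n2 ->]] /colors2[m3 [n3 ->]].
  move=> _ _ _ _ _ e1 e2 e3; have ? : z1 = n1 := e1.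
  have ? : z2 = n2 := e2; have ? : z3 = n3 := e3; subst n1 n2 n3.
  exact: CRMove3'.
Qed.

End Invariance.

Theorem proposition3 (X : finBiquandle) (S : {set endo X}) (A : zmodType)
    (W : (X * X) * (X * X) -> A) (hW : arrow_weight W)
    (D D' : gaussDiagram) (hDD' : same_virtual_knot D D') :
  indegree_polynomial (quiver W S D) = indegree_polynomial (quiver W S D') /\
  two_variable_polynomial (quiver W S D)
    = two_variable_polynomial (quiver W S D').
Proof.
elim: hDD' => {D D'} [D D' [hD | hD]|D|D D' _ [-> ->]|D1 D2 D3 _ [-> ->] _] //.
  exact: same_polynomials_homeo.
exact: same_polynomials_move.
Qed.
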